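(* Fix $1<p<\infty$ and a supplied accuracy $\varepsilon>0$. (a) For every deterministic strict local exact value-gradient method (which may depend on $\varepsilon$), every positive integer $N$, and every prescribed initial point $x_0\in\mathbb R$, there is a convex, coercive $C^1$ function $f:\mathbb R\to\mathbb R$ with a unique minimizer $x^*$ and exact gradient-Lipschitz constant $L>0$ (i.e. $L$ is the smallest Lipschitz constant of $f'$) such that, with $R:=|x^*-x_0|$, one has $LR/\varepsilon=4$, none of the first $N$ queries $x$ made by the method on $f$ satisfies $|f'(x)|\le\varepsilon$, and, if the method additionally produces a finite output point that is a measurable function of its $N$-query transcript, $f$ can be chosen so that this output point also has gradient magnitude larger than $\varepsilon$. (b) For every randomized strict local exact value-gradient method, every finite horizon $N$, every prescribed $x_0\in\mathbb R$, and every $\delta\in(0,1)$, there is one deterministic (non-random) function $f$ of the same kind (convex, coercive, $C^1$, with a unique minimizer $x^*$ and exact gradient-Lipschitz constant $L>0$) with $LR/\varepsilon=4$, $R=|x^*-x_0|$, such that the probability that any of the first $N$ queries, or any finite transcript-measurable output after $N$ queries, has gradient magnitude at most $\varepsilon$ is at most $\delta$. (c) Consequently, for every such method, the supremum over instances $f$ with $LR/\varepsilon=4$ of the expected hitting time of an $\varepsilon$-gradient point (the expected number of queries until a queried or returned point $x$ has $|f'(x)|\le\varepsilon$) is infinite. The statement holds simultaneously for every $\ell_p/\ell_q$ geometry with $1<p<\infty$, because all $\ell_p$ norms on $\mathbb R$ equal the absolute value.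
   Context: Strict counted local model: the procedure begins from an initial point $x_0$. Each query at a point $x\in\mathbb R$ returns the exact pair $(f(x),f'(x))$. The next query, and the final finite output if any, are measurable functions of the finite transcript of past queries and answers (and of internal randomness, if the method is randomized). No nondegenerate secant observation is supplied, and no other access to $f$ (e.g. line minimization) is allowed. The accuracy $\varepsilon$ is known to the method. Coercive means $f(x)\to+\infty$ as $|x|\to\infty$. *)

(* Defs.v *)
From HB Require Import structures.
From mathcomp Require Export all_boot all_order all_algebra.
From mathcomp Require Export all_classical all_reals all_analysis.
Export Order.TTheory GRing.Theory Num.Theory.
Export numFieldNormedType.Exports.

Set Implicit Arguments.
Unset Strict Implicit.
Unset Printing Implicit Defensive.

Local Open Scope classical_set_scope.
Local Open Scope ring_scope.

Definition lp_norm (R : realType) (n : nat) (p : R) (v : 'rV[R]_n) : R :=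
  (\sum_(i < n) `|v ord0 i| `^ p) `^ p^-1.

(* The l_p norm on R, seen as R^1. *)
Definition lp_norm1 (R : realType) (p x : R) : R :=
  @lp_norm R 1 p (const_mx x).

(* Lipschitz bound for a gradient field g on R^1, where points are measured in
   l_p and gradients in the dual norm l_q. *)
Definition lp_lipschitz (R : realType) (p q : R) (g : R -> R) (L : R) : Prop :=
  forall x y, lp_norm1 q (g x - g y) <= L * lp_norm1 p (x - y).

Definition exact_lipschitz (R : realType) (p q : R) (g : R -> R) (L : R) :
    Prop :=
  lp_lipschitz p q g L /\ forall K, lp_lipschitz p q g K -> L <= K.

Definition coercive (R : realType) (f : R -> R) : Prop :=
  f x @[x --> +oo] --> +oo /\ f x @[x --> -oo] --> +oo.

Definition continuously_differentiable (R : realType) (f : R -> R) : Prop :=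
  (forall x, derivable f x 1) /\ continuous (derive1 f).

Definition minimizer (R : realType) (f : R -> R) (x : R) : Prop :=
  forall y, f x <= f y.

Definition unique_minimizer (R : realType) (f : R -> R) (x : R) : Prop :=
  minimizer f x /\ forall z, minimizer f z -> z = x.

Definition instance (R : realType) (p q eps x0 : R) (f : R -> R) : Prop :=
  [/\ @convex_function R R^o [set: R^o] f,
      coercive f,
      continuously_differentiable f &
      exists L xstar : R,
        [/\ 0 < L, exact_lipschitz p q (derive1 f) L, unique_minimizer f xstar &
            L * lp_norm1 p (xstar - x0) / eps = 4]].

Definition stationary (R : realType) (q eps : R) (f : R -> R) (x : R) : Prop :=
  lp_norm1 q (derive1 f x) <= eps.

(* The entries are the triples (x, f x, f' x) of the queries made so far, in
   chronological order. *)
Definition transcript (R : realType) (n : nat) := (n.-tuple (R * R * R))%type.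

(* [query n t] is the next query after the n-query transcript t; [output n t]
   is the point returned after t, if any.  Whether a point is returned may
   depend on t, and returning one does not stop the queries, so that methods
   with or without output, for a fixed horizon or with a data-dependent stopping
   rule, are all covered. *)
Record strategy (R : realType) := Strategy {
  query : forall n, transcript R n -> R;
  output : forall n, transcript R n -> option R }.

Fixpoint run (R : realType) (S : strategy R) (f : R -> R) (n : nat) :
    transcript R n :=
  match n with
  | 0 => [tuple]
  | k.+1 => let t := run S f k in let x := query S t in
            [tuple of rcons t (x, f x, derive1 f x)]
  end.

(* The query of index n, counting from 0. *)
Definition query_point (R : realType) (S : strategy R) (f : R -> R) (n : nat) :
    R :=
  query S (run S f n).

Definition output_point (R : realType) (S : strategy R) (f : R -> R)
    (n : nat) : option R :=
  output S (run S f n).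

(* One of the first n queries, or the point returned after them, is
   eps-stationary. *)
Definition success (R : realType) (q eps : R) (f : R -> R) (S : strategy R)
    (n : nat) : Prop :=
  (exists2 i, (i < n)%N & stationary q eps f (query_point S f i)) \/
  (exists2 y, output_point S f n = Some y & stationary q eps f y).

(* Equal to +oo when there is no success. *)
Definition hitting_time (R : realType) (q eps : R) (f : R -> R)
    (S : strategy R) : \bar R :=
  ereal_inf [set (n%:R)%:E | n in [set n : nat | success q eps f S n]].

(* Measurability for the sum sigma-algebra on [option R] = R + {None}. *)
Definition measurable_partial (R : realType) (d : measure_display)
    (T : measurableType d) (g : T -> option R) : Prop :=
  forall A : set R, measurable A -> measurable (g @^-1` (Some @` A)).

(* In the two classes of methods below, the first argument is the prescribed
   initial point.  The first query [query S [tuple]] is not forced to be that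
   point, but the methods for which it is are included. *)
Definition deterministic_method (R : realType) (M : R -> strategy R) : Prop :=
  forall x0 n,
    measurable_fun [set: transcript R n] (fun t => query (M x0) t) /\
    measurable_partial (fun t : transcript R n => output (M x0) t).

(* The points of Omega are the values of the internal randomness. *)
Definition randomized_method (R : realType) (d : measure_display)
    (Omega : measurableType d) (M : R -> Omega -> strategy R) : Prop :=
  forall x0 n,
    measurable_fun [set: Omega * transcript R n]
      (fun z => query (M x0 z.1) z.2) /\
    measurable_partial
      (fun z : Omega * transcript R n => output (M x0 z.1) z.2).

(* Main.v *)
Require Import Defs.
From mathcomp Require Import ring lra.
From mathcomp Require Import measurable_realfun.

(** Nothing in the budget LR = 4 eps fixes the scale R, and a method that has
    only met the affine function with slope -2 eps cannot tell how far away the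
    minimizer lies.  Let [line] be that affine function, vanishing at x0.  For
    every r > 0 there is an instance, [hard eps r x0], whose derivative is -2 eps
    up to x0 + r, climbs with slope 2 eps / r, vanishes at x0 + 2 r and is 2 eps
    from x0 + 3 r on.  It has L = 2 eps / r and R = 2 r, hence LR / eps = 4 for
    every r, and it coincides with [line], value and derivative, on the whole
    half-line x <= x0 + r, where its gradient has magnitude 2 eps > eps.

    Let a method run on [line].  Its first N queries and its outputs are finitely
    many numbers, so they stay below some bound, the [reach] of the run.  If
    x0 + r is at least that bound, the run on the hard instance is literally the
    same run ([eq_run]), and no point in it is eps-stationary
    ([no_success_within_reach]).  This is the deterministic statement.

    With internal randomness the reach is a real random variable, whose
    distribution does not depend on r.  Its tail tends to zero
    ([probability_tail_small]), so some fixed r works outside an event of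
    probability at most delta ([randomized_hard_instance]).  Both bounds hold for
    all horizons up to N at once, so the hitting time is at least N, surely or
    with probability at least 1/2, and its expectation is unbounded over the
    instances.

    The instance is a shifted and scaled Huber function.  Its convexity,
    smoothness, coercivity and unique minimizer are all read off from one
    inequality, the one saying that [hard_slope] is a field of subgradients,
    together with the Lipschitz bound on that field. *)

Set Implicit Arguments.
Unset Strict Implicit.
Unset Printing Implicit Defensive.

Local Open Scope classical_set_scope.
Local Open Scope ring_scope.

(** * Convex functions given by a Lipschitz field of subgradients *)

Lemma continuous_at_lipschitz (R : realType) (g : R -> R) (K x : R) :
  (forall z, `|g z - g x| <= K * `|z - x|) -> {for x, continuous g}.
Proof.
move=> gK; apply/(@cvgrPdist_lt _ R^o) => e e0.
have K0 : 0 < `|K| + 1 by rewrite ltr_wpDl.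
near=> z.
have zx : `|z - x| < e / (`|K| + 1).
  rewrite distrC; near: z; apply: (@cvgr_dist_lt _ R^o) => //.
  by rewrite divr_gt0.
rewrite distrC (le_lt_trans (gK z))//.
rewrite ltr_pdivlMr// mulrC in zx; apply: le_lt_trans zx.
by rewrite ler_wpM2r// (le_trans (ler_norm _))// lerDl.
Unshelve. all: by end_near. Qed.

Section subgradient.
Variables (R : realType) (f g : R -> R) (K : R).
Hypothesis fg : forall x y, f x + g x * (y - x) <= f y.
Hypothesis gK : forall x y, `|g x - g y| <= K * `|x - y|.

(** The two subgradient inequalities at x and z squeeze f z - f x between
    g x (z - x) and g z (z - x), so the difference quotient is within K |z - x|
    of g x. *)
Lemma subgradient_is_derive (x : R) : is_derive x (1 : R) f (g x).
Proof.
apply/is_derive1_caratheodory.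
exists (fun z => if z == x then g x else (f z - f x) / (z - x)); split.
- by move=> z; case: eqVneq => [->|zx]; rewrite ?subrr ?mulr0 ?divfK// subr_eq0.
- apply: (@continuous_at_lipschitz _ _ K) => z; rewrite eqxx.
  have [->|zx] := eqVneq z x; first by rewrite !subrr normr0 mulr0.
  have zx0 : z - x != 0 by rewrite subr_eq0.
  rewrite -(ler_pM2r (_ : 0 < `|z - x|)) ?normr_gt0//.
  rewrite -normrM mulrBl divfK// -mulrA -normrM.
  have := fg x z; have := fg z x => fzx fxz.
  rewrite ger0_norm ?subr_ge0; last by lra.
  apply: (@le_trans _ _ ((g z - g x) * (z - x))); first by lra.
  rewrite (le_trans (ler_norm _))// !normrM mulrA ler_wpM2r//.
- by rewrite eqxx.
Qed.

Lemma subgradient_derivable (x : R) : derivable f x 1.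
Proof. by have [] := subgradient_is_derive x. Qed.

Lemma subgradient_derive1 : derive1 f = g.
Proof.
apply/funext => x; rewrite derive1E.
by have [_ ->] := subgradient_is_derive x.
Qed.

Lemma subgradient_C1 : continuously_differentiable f.
Proof.
split; first exact: subgradient_derivable.
rewrite subgradient_derive1 => x; exact: (@continuous_at_lipschitz _ _ K).
Qed.

(** The supporting line of f at the mean point z lies below f at a and at b, and
    the mean of its values there is f z. *)
Lemma subgradient_convex : @convex_function R R^o [set: R^o] f.
Proof.
move=> t a b _ _.
change (f (t%:num * (a : R) + (1 - t%:num) * (b : R))
  <= t%:num * f a + (1 - t%:num) * f b).
have s0 : 0 <= t%:num by [].
have s1 : 0 <= 1 - t%:num by rewrite subr_ge0.
set s := t%:num in s0 s1 *; set z := s * _ + _.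
have := lerD (ler_wpM2l s0 (fg z a)) (ler_wpM2l s1 (fg z b)).
apply: le_trans; rewrite le_eqVlt; apply/orP; left; apply/eqP.
by rewrite /z; ring.
Qed.

(** A supporting line of negative slope forces f to +oo at -oo, one of positive
    slope at +oo. *)
Lemma subgradient_coercive (y z : R) : g y < 0 -> 0 < g z -> coercive f.
Proof.
move=> gy gz; split; apply/cvgryPge => A; near=> x.
- apply: le_trans _ (fg z x).
  rewrite -lerBlDl mulrC -ler_pdivrMr// lerBrDr; near: x.
  exact: nbhs_pinfty_ge (num_real _).
- apply: le_trans _ (fg y x).
  rewrite -lerBlDl mulrC -ler_ndivlMr// lerBlDr; near: x.
  exact: nbhs_ninfty_le (num_real _).
Unshelve. all: by end_near. Qed.

Lemma subgradient_unique_minimizer (x : R) :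
  g x = 0 -> (forall z, g z = 0 -> z = x) -> unique_minimizer f x.
Proof.
move=> gx gz; split; first by move=> y; have := fg x y; rewrite gx mul0r addr0.
move=> z zmin; apply: gz.
have zd : is_derive z 1 f 0.
  apply: (@derive1_at_min _ _ (z - 1) (z + 1)) => //.
  - by lra.
  - by move=> t _; exact: subgradient_derivable.
  - by rewrite in_itv/=; apply/andP; split; lra.
by rewrite -subgradient_derive1 derive1E; have [_ ->] := zd.
Qed.

End subgradient.

(** * The hard instances *)

Section instances.
Variable R : realType.
Implicit Types eps r x u v s : R.

Lemma lp_norm1E p x : p != 0 -> lp_norm1 p x = `|x|.
Proof.
by move=> p0; rewrite /lp_norm1 /lp_norm big_ord1 mxE -powRrM mulfV// powRr1.
Qed.

Definition clamp r u : R := Num.max (- r) (Num.min u r).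

Variant clamp_spec r u : R -> Prop :=
| ClampLeft of u <= - r : clamp_spec r u (- r)
| ClampMid of - r <= u <= r : clamp_spec r u u
| ClampRight of r <= u : clamp_spec r u r.

Lemma clampP r u : 0 < r -> clamp_spec r u (clamp r u).
Proof.
move=> r0; rewrite /clamp /Num.max /Num.min.
by case: ifP => [|/negbT]; case: ifP => [|/negbT]; rewrite -?leNgt => ? ?;
  constructor; lra.
Qed.

Lemma clamp_left r u : 0 < r -> u <= - r -> clamp r u = - r.
Proof. by move=> r0; case: clampP => // *; lra. Qed.

Lemma clamp_right r u : 0 < r -> r <= u -> clamp r u = r.
Proof. by move=> r0; case: clampP => // *; lra. Qed.

Lemma clamp0 r : 0 < r -> clamp r 0 = 0.
Proof. by move=> r0; case: clampP => // *; lra. Qed.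

Lemma clamp_bound r u : 0 < r -> - r <= clamp r u <= r.
Proof. by move=> r0; case: clampP => // h; lra. Qed.

Lemma clamp_lipschitz r u v : 0 < r ->
  `|clamp r u - clamp r v| <= `|u - v|.
Proof.
move=> r0; rewrite ler_norml; have := ler_norm (u - v).
have := ler_norm (v - u); rewrite (distrC v).
by case: clampP => //; case: clampP => // *; lra.
Qed.

Lemma clamp_eq0 r u : 0 < r -> clamp r u = 0 -> u = 0.
Proof. by move=> r0; case: clampP => // *; lra. Qed.

Definition huber r u : R := clamp r u * (2 * u - clamp r u).

(** [huber r] is the supremum of the affine functions u |-> s (2 u - s) with
    |s| <= r.  Since s (2 u - s) = u^2 - (u - s)^2, the best s is the projection
    of u on [-r, r]. *)
Lemma huber_sup r u s : 0 < r -> - r <= s <= r -> s * (2 * u - s) <= huber r u.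
Proof.
move=> r0 /andP[rs sr]; rewrite /huber -subr_ge0; case: clampP => // ru.
- rewrite (_ : _ - _ = (s + r) * (s - r - 2 * u)); last by ring.
  by apply: mulr_ge0; lra.
- by rewrite (_ : _ - _ = (u - s) ^+ 2) ?sqr_ge0//; ring.
- rewrite (_ : _ - _ = (r - s) * (2 * u - r - s)); last by ring.
  by apply: mulr_ge0; lra.
Qed.

Lemma huber_subgradient r u v : 0 < r ->
  huber r u + 2 * clamp r u * (v - u) <= huber r v.
Proof.
move=> r0; apply: le_trans (huber_sup v r0 (clamp_bound u r0)).
by rewrite /huber; lra.
Qed.

(** The constant makes this function vanish at x0, and so agree with [line] and
    not merely up to a constant: the values are observed too. *)
Definition hard eps r x0 x : R :=
  eps / r * huber r (x - (x0 + 2 * r)) - 3 * eps * r.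

Definition hard_slope eps r x0 x : R :=
  2 * eps / r * clamp r (x - (x0 + 2 * r)).

Definition line eps x0 x : R := - (2 * eps) * (x - x0).

Section hard_instance.
Variables eps r x0 : R.
Hypotheses (eps0 : 0 < eps) (r0 : 0 < r).

Let er0 : 0 < eps / r. Proof. exact: divr_gt0. Qed.

Lemma hard_subgradient x y :
  hard eps r x0 x + hard_slope eps r x0 x * (y - x) <= hard eps r x0 y.
Proof.
have := huber_subgradient (x - (x0 + 2 * r)) (y - (x0 + 2 * r)) r0.
by move=> /(ler_wpM2l (ltW er0)); rewrite /hard /hard_slope; lra.
Qed.

Lemma hard_slope_lipschitz x y :
  `|hard_slope eps r x0 x - hard_slope eps r x0 y| <= 2 * eps / r * `|x - y|.
Proof.
have L0 : 0 < 2 * eps / r by rewrite -mulrA mulr_gt0.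
rewrite -mulrBr normrM (gtr0_norm L0) ler_pM2l//.
apply: le_trans (clamp_lipschitz _ _ r0) _.
by rewrite opprB addrA subrK.
Qed.

Lemma derive1_hard : derive1 (hard eps r x0) = hard_slope eps r x0.
Proof. exact: subgradient_derive1 hard_subgradient hard_slope_lipschitz. Qed.

(** The gradient passes from -2 eps at x0 + r to 2 eps at x0 + 3 r, and this pair
    of points attains the Lipschitz constant. *)
Lemma hard_instance p q : p != 0 -> q != 0 ->
  instance p q eps x0 (hard eps r x0).
Proof.
move=> p0 q0.
have slope x c : clamp r (x - (x0 + 2 * r)) = c ->
    hard_slope eps r x0 x = 2 * eps / r * c by rewrite /hard_slope => ->.
have slopeN : hard_slope eps r x0 (x0 + r) = - (2 * eps).
  rewrite (slope _ (- r)); first by field; rewrite gt_eqF.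
  by rewrite clamp_left//; lra.
have slopeP : hard_slope eps r x0 (x0 + 3 * r) = 2 * eps.
  rewrite (slope _ r); first by field; rewrite gt_eqF.
  by rewrite clamp_right//; lra.
have slope0 : hard_slope eps r x0 (x0 + 2 * r) = 0.
  by rewrite (slope _ 0) ?mulr0// subrr clamp0.
split.
- exact: subgradient_convex hard_subgradient.
- apply: (subgradient_coercive hard_subgradient
    (y := x0 + r) (z := x0 + 3 * r)).
    by rewrite slopeN oppr_lt0 mulr_gt0.
  by rewrite slopeP mulr_gt0.
- exact: subgradient_C1 hard_subgradient hard_slope_lipschitz.
- exists (2 * eps / r), (x0 + 2 * r); rewrite derive1_hard; split.
  + by rewrite -mulrA mulr_gt0.
  + split=> [x y|K /(_ (x0 + 3 * r) (x0 + r))].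
      by rewrite !lp_norm1E//; exact: hard_slope_lipschitz.
    rewrite !lp_norm1E// slopeP slopeN.
    rewrite (_ : _ - - _ = 2 * eps / r * (2 * r)); last first.
      by field; rewrite gt_eqF.
    rewrite (_ : x0 + _ - _ = 2 * r); last by ring.
    have r20 : 0 < 2 * r by rewrite mulr_gt0.
    rewrite ger0_norm ?(gtr0_norm r20) ?ler_pM2r//.
    by rewrite !mulr_ge0// ?invr_ge0 ltW.
  + apply: subgradient_unique_minimizer hard_subgradient
      hard_slope_lipschitz _ slope0 _ => z /eqP.
    rewrite mulf_eq0 => /orP[|/eqP /(clamp_eq0 r0)]; last by lra.
    by rewrite -mulrA mulf_eq0 pnatr_eq0/= gt_eqF.
  + rewrite lp_norm1E// (_ : x0 + _ - _ = 2 * r); last by ring.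
    by rewrite gtr0_norm ?mulr_gt0//; field; rewrite !gt_eqF.
Qed.

(** An affine function has its constant slope as subgradient, with Lipschitz
    constant 0. *)
Lemma derive1_line : derive1 (line eps x0) = cst (- (2 * eps)).
Proof.
apply: (@subgradient_derive1 _ _ _ 0) => x y.
  by rewrite /line /=; lra.
by rewrite subrr normr0 mul0r.
Qed.

Lemma hard_eq_line x : x <= x0 + r ->
  hard eps r x0 x = line eps x0 x /\
  derive1 (hard eps r x0) x = derive1 (line eps x0) x.
Proof.
move=> xr; have cr : clamp r (x - (x0 + 2 * r)) = - r.
  by rewrite clamp_left//; lra.
rewrite derive1_hard derive1_line /hard /huber /hard_slope cr /line.
by split=> /=; field; rewrite gt_eqF.
Qed.

End hard_instance.
End instances.

(** * Runs that stay in the common half-line *)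

Section runs.
Variable R : realType.
Implicit Types (S : strategy R) (f h : R -> R).

(** A sum is a crude bound on the points of a run, but it is visibly measurable in
    the internal randomness.  A missing output counts as the point 0. *)
Definition reach S f (N : nat) : R :=
  \sum_(n < N.+1)
    (`|query_point S f n| + `|odflt 0 (output_point S f n)|).

Lemma le_reach S f N n : (n <= N)%N ->
  `|query_point S f n| + `|odflt 0 (output_point S f n)| <= reach S f N.
Proof.
move=> nN; rewrite /reach (bigD1 (Ordinal (nN : (n < N.+1)%N)))//= lerDl.
by apply: sumr_ge0 => i _; rewrite addr_ge0.
Qed.

Lemma query_le_reach S f N n : (n <= N)%N -> query_point S f n <= reach S f N.
Proof.
move=> /(le_reach S f); apply: le_trans.
by rewrite (le_trans (ler_norm _))// lerDl.
Qed.

Lemma output_le_reach S f N n y : (n <= N)%N -> output_point S f n = Some y ->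
  y <= reach S f N.
Proof.
move=> /(le_reach S f) + fy; rewrite fy /=; apply: le_trans.
by rewrite (le_trans (ler_norm _))// lerDr.
Qed.

(** It is enough that the run on h stays in the half-line: by induction the run on
    f then asks the same queries and receives the same answers. *)
Lemma eq_run S f h (a : R) :
    (forall x, x <= a -> f x = h x /\ derive1 f x = derive1 h x) ->
  forall n, (forall i, (i < n)%N -> query_point S h i <= a) ->
  run S f n = run S h n.
Proof.
move=> fh; elim=> [//|n IH] qa /=.
rewrite IH => [|i /leqW]; last exact: qa.
by have [-> ->] := fh _ (qa n (leqnn _)).
Qed.

Lemma eq_run_reach S f h (a : R) (N : nat) :
    (forall x, x <= a -> f x = h x /\ derive1 f x = derive1 h x) ->
    reach S h N <= a ->
  forall n, (n <= N)%N ->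
  query_point S f n = query_point S h n /\
  output_point S f n = output_point S h n.
Proof.
move=> fh ha n nN; rewrite /query_point /output_point (eq_run fh)// => i ni.
by apply: le_trans ha; apply: query_le_reach; rewrite ltnW// (leq_trans ni).
Qed.

Lemma no_success_within_reach (q eps r x0 : R) S (N : nat) :
    q != 0 -> 0 < eps -> 0 < r -> reach S (line eps x0) N <= x0 + r ->
  forall n, (n <= N)%N -> ~ success q eps (hard eps r x0) S n.
Proof.
move=> q0 eps0 r0 Sr n nN.
have same := eq_run_reach (hard_eq_line eps0 r0) Sr.
have steep x : x <= x0 + r -> ~ stationary q eps (hard eps r x0) x.
  move=> /(hard_eq_line eps0 r0)[_ dx].
  rewrite /stationary lp_norm1E// dx derive1_line /cst normrN.
  by rewrite gtr0_norm ?mulr_gt0//; lra.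
case=> [[i ni]|[y]].
  have iN : (i <= N)%N by rewrite ltnW// (leq_trans ni).
  have [-> _] := same _ iN; apply: steep; apply: le_trans Sr.
  exact: query_le_reach.
have [_ ->] := same _ nN => yS; apply: steep; apply: le_trans Sr.
exact: output_le_reach yS.
Qed.

End runs.

(** * Measurability of runs *)

Lemma measurable_rcons d1 d2 (T1 : measurableType d1) (T2 : measurableType d2)
    (f : T1 -> T2) n (g : T1 -> n.-tuple T2) :
  measurable_fun [set: T1] f -> measurable_fun [set: T1] g ->
  measurable_fun [set: T1] (fun x => [tuple of rcons (g x) (f x)]).
Proof.
move=> mf mg; apply/measurable_fun_tnthP => i.
have [ni|ni] := ltnP i n.
- rewrite (_ : _ \o _ = fun x => tnth (g x) (Ordinal ni)).
    by apply: (measurableT_comp (measurable_tnth (Ordinal ni))).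
  apply/funext => x /=; rewrite (tnth_nth (f x)) (tnth_nth (f x)) /=.
  by rewrite nth_rcons size_tuple ni.
- rewrite (_ : _ \o _ = f)//.
  apply/funext => x /=; rewrite (tnth_nth (f x)) /= nth_rcons size_tuple.
  by rewrite ltnNge ni/=; case: ifP.
Qed.

Section measurable_runs.
Context d (R : realType) (T : measurableType d).
Variables (S : T -> strategy R) (f : R -> R).
Hypothesis mS : forall n,
  measurable_fun [set: T * transcript R n] (fun z => query (S z.1) z.2) /\
  measurable_partial (fun z : T * transcript R n => output (S z.1) z.2).
Hypothesis mf : measurable_fun [set: R] f.
Hypothesis mdf : measurable_fun [set: R] (derive1 f).

Let pair_run n (w : T) : T * transcript R n := (w, run (S w) f n).

(** Stated for a run already known to be measurable, so that it also serves in the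
    induction of [measurable_run]. *)
Lemma measurable_query_point_of_run n :
  measurable_fun [set: T] (fun w => run (S w) f n) ->
  measurable_fun [set: T] (fun w => query_point (S w) f n).
Proof.
move=> mr; have mp : measurable_fun [set: T] (pair_run n).
  exact/measurable_fun_pair.
exact: (measurableT_comp (mS n).1 mp).
Qed.

Lemma measurable_run n : measurable_fun [set: T] (fun w => run (S w) f n).
Proof.
elim: n => [|n IH] /=; first exact: measurable_cst.
have mq := measurable_query_point_of_run IH.
apply: measurable_rcons => //.
apply/measurable_fun_pair; first apply/measurable_fun_pair => //.
- exact: (measurableT_comp mf).
- exact: (measurableT_comp mdf).
Qed.

Lemma measurable_query_point n :
  measurable_fun [set: T] (fun w => query_point (S w) f n).
Proof. exact/measurable_query_point_of_run/measurable_run. Qed.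

Lemma measurable_output_point n :
  measurable_partial (fun w => output_point (S w) f n).
Proof.
move=> A mA.
have mp : measurable_fun [set: T] (pair_run n).
  by apply/measurable_fun_pair => //; exact: measurable_run.
have := mp measurableT _ ((mS n).2 A mA); rewrite setTI; exact.
Qed.

(** A preimage of A contains the points where g is undefined exactly when c is in
    A; in that case the complement is a preimage of defined values only. *)
Lemma measurable_odflt (g : T -> option R) (c : R) : measurable_partial g ->
  measurable_fun [set: T] (fun w => odflt c (g w)).
Proof.
move=> mg _ A mA; rewrite setTI.
have [Ac|Ac] := pselect (A c).
  rewrite (_ : _ @^-1` _ = ~` (g @^-1` (Some @` (~` A)))).
    by apply: measurableC; apply: mg; exact: measurableC.
  apply/seteqP; split=> w /=.
    by move=> + [y Ay gy]; rewrite -gy.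
  by case: (g w) => //= y; apply: contra_notP => Ay; exists y.
rewrite (_ : _ @^-1` _ = g @^-1` (Some @` A)); first exact: mg.
apply/seteqP; split=> w /=.
  by case: (g w) => //= y Ay; exists y.
by move=> [y Ay <-].
Qed.

Lemma measurable_reach N : measurable_fun [set: T] (fun w => reach (S w) f N).
Proof.
apply: measurable_sum => n; apply: measurable_funD.
- apply: (measurableT_comp (@normr_measurable R setT)).
  exact: measurable_query_point.
- apply: (measurableT_comp (@normr_measurable R setT)).
  exact/measurable_odflt/measurable_output_point.
Qed.

Lemma measurable_success (q eps : R) (N : nat) : q != 0 ->
  measurable [set w | success q eps f (S w) N].
Proof.
move=> q0.
have mstat : measurable [set x | stationary q eps f x].
  rewrite (_ : mkset _ = [set x | `|derive1 f x| <= eps]).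
    rewrite -[X in measurable X]setTI.
    apply: measurable_fun_le => //; apply: measurableT_comp => //.
  by apply/funext => x; rewrite /mkset /stationary lp_norm1E.
rewrite (_ : mkset _ =
    (\bigcup_(i in [set i | (i < N)%N])
      ((fun w => query_point (S w) f i) @^-1` [set x | stationary q eps f x]))
    `|` ((fun w => output_point (S w) f N) @^-1`
      (Some @` [set x | stationary q eps f x]))).
  apply: measurableU; last exact: measurable_output_point.
  apply: bigcup_measurable => i _.
  by rewrite -[X in measurable X]setTI; exact: measurable_query_point.
apply/seteqP; split=> w /= [[i iN iS]|[y yS Sy]].
- by left; exists i.
- by right; exists y.
- by left; exists i.
- by right; exists y.
Qed.

End measurable_runs.

(** * Randomized methods *)

Section randomized.
Context d (Omega : measurableType d) (R : realType) (P : probability Omega R).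

Lemma probability_tail_small (X : Omega -> R) (a delta : R) :
  measurable_fun [set: Omega] X -> 0 < delta ->
  exists2 b, a <= b & (P [set w | (b < X w)%R] <= delta%:E)%E.
Proof.
move=> mX delta0.
pose Y : {RV P >-> R} := @mfun_Sub _ _ _ _ X (mem_set mX).
have tail : \forall b \near +oo, (ccdf Y b < delta%:E)%E.
  have := @cvg_ccdfy0 _ _ _ P Y [set x | x < delta%:E]%E.
  apply; apply: open_nbhs_nbhs; split; last by rewrite /= lte_fin.
  exact: open_ereal_lt_ereal.
near (pinfty_nbhs R) => b; exists b.
  by near: b; exact: nbhs_pinfty_ge (num_real _).
have : (ccdf Y b < delta%:E)%E by near: b.
rewrite /ccdf /distribution /pushforward /= => /ltW; congr (P _ <= _)%E.
by apply/seteqP; split=> w /=; rewrite in_itv/= andbT.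
Unshelve. all: by end_near. Qed.

Lemma measurable_hard_success (q eps r : R) (M : R -> Omega -> strategy R)
    (x0 : R) (n : nat) :
  q != 0 -> 0 < eps -> 0 < r -> randomized_method M ->
  measurable [set w | success q eps (hard eps r x0) (M x0 w) n].
Proof.
move=> q0 eps0 r0 /(_ x0) mM.
have [fd dfc] : continuously_differentiable (hard eps r x0).
  exact: subgradient_C1 (hard_subgradient _ eps0 r0)
    (hard_slope_lipschitz _ eps0 r0).
apply: measurable_success => //; last exact: continuous_measurable_fun.
apply: continuous_measurable_fun => x.
by apply: differentiable_continuous; apply/derivable1_diffP.
Qed.

(** The reach is that of the runs on [line], which does not mention r: r can be
    chosen after its distribution is known.  Measurability of the event is part of
    the conclusion, for comparing it with smaller events and taking its
    complement. *)
Lemma randomized_hard_instance (q eps : R) (M : R -> Omega -> strategy R)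
    (N : nat) (x0 delta : R) :
  q != 0 -> 0 < eps -> randomized_method M -> 0 < delta ->
  exists2 r, 0 < r &
    let E := [set w | exists2 n, (n <= N)%N &
                success q eps (hard eps r x0) (M x0 w) n] in
    measurable E /\ (P E <= delta%:E)%E.
Proof.
move=> q0 eps0 mM delta0.
have ml : measurable_fun [set: R] (line eps x0).
  by apply: measurable_funM => //; exact: measurable_funB.
have mdl : measurable_fun [set: R] (derive1 (line eps x0)).
  by rewrite derive1_line; exact: measurable_cst.
have mreach := measurable_reach (mM x0) ml mdl N.
have [b xb Pb] := probability_tail_small (x0 + 1) mreach delta0.
have r0 : 0 < b - x0 by lra.
exists (b - x0) => //=; set E := mkset _.
have mE : measurable E.
  rewrite (_ : E = \bigcup_(n in [set n | (n <= N)%N])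
      [set w | success q eps (hard eps (b - x0) x0) (M x0 w) n])//.
  by apply: bigcup_measurable => n _; exact: measurable_hard_success.
split=> //; apply: le_trans Pb; apply: le_measure; rewrite ?inE//.
  rewrite (_ : mkset _ =
      (fun w => reach (M x0 w) (line eps x0) N) @^-1` `]b, +oo[%classic).
    by rewrite -[X in measurable X]setTI; exact: mreach.
  by apply/seteqP; split=> w /=; rewrite in_itv/= andbT.
move=> w [n nN nS] /=; rewrite ltNge; apply/negP => wb.
apply: no_success_within_reach nN nS => //.
by rewrite addrC subrK.
Qed.

(** c times the indicator of the complement of E is one of the simple functions
    below T over which the integral of T is a supremum. *)
Lemma integral_ge_cst_off (E : set Omega) (T : Omega -> \bar R) (c : R) :
  measurable E -> 0 <= c -> (forall w, 0 <= T w)%E ->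
  (forall w, ~ E w -> c%:E <= T w)%E ->
  (c%:E * (1 - P E) <= \int[P]_w T w)%E.
Proof.
move=> mE c0 T0 cT.
rewrite -probability_setC// ge0_integralTE//.
apply: ereal_sup_ubound => /=.
exists (scale_nnsfun (indic_nnsfun R (measurableC mE)) c0).
  move=> w; rewrite /= /mindic indicE; case: (pselect (E w)) => Ew.
    by rewrite memNset ?mulr0//= => /(_ Ew).
  by rewrite mem_set// mulr1; exact: cT.
by rewrite sintegralrM/= sintegral_indic.
Qed.

End randomized.

(** * The lower bounds *)

Section hitting.
Variable R : realType.

Lemma hitting_time_ge (q eps : R) f (S : strategy R) (N : nat) :
  (forall n, (n <= N)%N -> ~ success q eps f S n) ->
  (N%:R%:E <= hitting_time q eps f S)%E.
Proof.
move=> noS; apply/ereal_infP => _ [n nS <-]; rewrite lee_fin ler_nat.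
by rewrite leqNgt; apply/negP => /ltnW /noS.
Qed.

Lemma hitting_time_ge0 (q eps : R) f (S : strategy R) :
  (0 <= hitting_time q eps f S)%E.
Proof. by apply/ereal_infP => _ [n nS <-]; rewrite lee_fin. Qed.

Lemma ereal_sup_eqy (A : set \bar R) :
  (forall N : nat, exists2 y, A y & N%:R%:E <= y)%E -> ereal_sup A = +oo%E.
Proof.
move=> An; apply: eq_infty => t.
have [y Ay Ny] := An (Num.bound `|t|).
apply: le_trans (ereal_sup_ubound Ay); apply: le_trans Ny.
by rewrite lee_fin ltW// (le_lt_trans (ler_norm _))// archi_boundP.
Qed.

End hitting.

Theorem theorem2p1 (R : realType) (p q eps : R) (p_gt1 : 1 < p)
    (pq_conj : p^-1 + q^-1 = 1) (eps_gt0 : 0 < eps) :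
  [/\ (* (a) *)
      (forall (M : R -> strategy R), deterministic_method M ->
       forall (N : nat) (x0 : R), (0 < N)%N ->
       exists f : R -> R,
         [/\ instance p q eps x0 f,
             forall i, (i < N)%N ->
               ~ stationary q eps f (query_point (M x0) f i) &
             forall y, output_point (M x0) f N = Some y ->
               eps < lp_norm1 q (derive1 f y)]),
      (* (b) *)
      (forall (d : measure_display) (Omega : measurableType d)
         (P : probability Omega R) (M : R -> Omega -> strategy R),
       randomized_method M ->
       forall (N : nat) (x0 delta : R), 0 < delta < 1 ->
       exists f : R -> R,
         instance p q eps x0 f /\
         (P [set w | success q eps f (M x0 w) N] <= delta%:E)%E),
      (* (c), deterministic and randomized *)
      (forall (M : R -> strategy R), deterministic_method M ->
       forall x0 : R,
       ereal_sup [set hitting_time q eps f (M x0)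
                 | f in [set f | instance p q eps x0 f]] = +oo%E) /\
      (forall (d : measure_display) (Omega : measurableType d)
         (P : probability Omega R) (M : R -> Omega -> strategy R),
       randomized_method M ->
       forall x0 : R,
       ereal_sup [set (\int[P]_w hitting_time q eps f (M x0 w))%E
                 | f in [set f | instance p q eps x0 f]] = +oo%E) &
      (* l_p geometries on R *)
      forall r x : R, 1 < r -> lp_norm1 r x = `|x|].
Proof.
have p0 : p != 0 by rewrite gt_eqF// (lt_trans ltr01).
have q0 : q != 0.
  apply/eqP => q0; move: pq_conj; rewrite q0 invr0 addr0 => /eqP.
  by rewrite invr_eq1 => /eqP p1; rewrite p1 ltxx in p_gt1.
(* Without randomness r only has to cover the reach; the maximum with 1 keeps it
   positive. *)
have det S N x0 : exists2 r, 0 < r &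
    forall n, (n <= N)%N -> ~ success q eps (hard eps r x0) S n.
  exists (Num.max 1 (reach S (line eps x0) N - x0)).
    by rewrite lt_max ltr01.
  apply: no_success_within_reach => //; first by rewrite lt_max ltr01.
  by rewrite -lerBlDl le_max lexx orbT.
have inst r x0 : 0 < r -> instance p q eps x0 (hard eps r x0).
  by move=> r0; exact: hard_instance.
split.
- move=> M _ N x0 _; have [r r0 fail] := det (M x0) N x0.
  exists (hard eps r x0); split; first exact: inst.
    by move=> i iN iS; apply: (fail N (leqnn N)); left; exists i.
  move=> y yM; rewrite ltNge; apply/negP => yS.
  by apply: (fail N (leqnn N)); right; exists y.
- move=> d Omega P M mM N x0 delta /andP[delta0 _].
  have [r r0 [mE PE]] := randomized_hard_instance P N x0 q0 eps_gt0 mM delta0.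
  exists (hard eps r x0); split; first exact: inst.
  apply: le_trans PE; apply: le_measure; rewrite ?inE//.
    exact: measurable_hard_success.
  by move=> w wS; exists N.
- split=> [M _ x0|d Omega P M mM x0].
    apply: ereal_sup_eqy => N; have [r r0 fail] := det (M x0) N x0.
    exists (hitting_time q eps (hard eps r x0) (M x0)).
      by exists (hard eps r x0) => //; exact: inst.
    exact: hitting_time_ge.
  apply: ereal_sup_eqy => N.
  (* Failure up to time 2 N with probability at least 1/2 contributes N. *)
  have h0 : 0 < 2^-1 :> R by rewrite invr_gt0.
  have [r r0 [mE PE]] :=
    randomized_hard_instance P (2 * N) x0 q0 eps_gt0 mM h0.
  exists (\int[P]_w hitting_time q eps (hard eps r x0) (M x0 w))%E.
    by exists (hard eps r x0) => //; exact: inst.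
  apply: le_trans (integral_ge_cst_off P mE (ler0n _ (2 * N)) _ _).
  - have -> : (N%:R%:E = (2 * N)%:R%:E * (1 - 2^-1%:E) :> \bar R)%E.
      by rewrite -EFinB -EFinM natrM; congr EFin; field.
    by apply: lee_wpmul2l; rewrite ?lee_fin// leeB.
  - by move=> w; exact: hitting_time_ge0.
  - move=> w nE; apply: hitting_time_ge => n nN nS; apply: nE.
    by exists n.
- by move=> r x r1; rewrite lp_norm1E// gt_eqF// (lt_trans ltr01).
Qed.
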